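(* Let $m\geq 1$ and $k \geq 2$ be integers and suppose that $q=p^{km}$ is a prime power ($p$ prime) such that $q \equiv 1 \bmod 2k$. Then the generalized Paley graph $\mathcal{P}(q, k)$ is connected.
   Context: For an integer $k\ge 2$ and a finite field $\mathbb{F}_q$ of order $q=p^n$ with $q \equiv 1 \bmod 2k$, let $(\mathbb{F}_q^{\times})^k=\{\alpha\in\mathbb{F}_q^\times \mid \alpha=\beta^k \text{ for some } \beta\in\mathbb{F}_q^\times\}$. The generalized Paley graph $\mathcal{P}(q,k)$ is the simple undirected graph with vertex set $\mathbb{F}_q$ in which $x,y$ are adjacent if and only if $x-y\in(\mathbb{F}_q^\times)^k$. (The congruence guarantees $q$ is odd and $-1\in(\mathbb{F}_q^\times)^k$.) *)

(* Defs.v *)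
From mathcomp Require Import all_boot all_algebra all_field.

Set Implicit Arguments.
Unset Strict Implicit.
Unset Printing Implicit Defensive.

Import GRing.Theory.
Local Open Scope ring_scope.

Definition unit_powers (F : finFieldType) (k : nat) : {set F} :=
  [set a : F | (a != 0) && [exists b : F, (b != 0) && (a == b ^+ k)]].

(* Adjacency of the generalized Paley graph on the vertex type F. This is the
   edge relation of a simple graph: see paley_irrefl and paley_sym. *)
Definition paley (F : finFieldType) (k : nat) : rel F :=
  [rel x y | x - y \in unit_powers F k].

Definition connected_graph (T : finType) (e : rel T) : Prop :=
  forall x y : T, connect e x y.

Lemma paley_irrefl (F : finFieldType) (k : nat) : irreflexive (@paley F k).
Proof. by move=> x; rewrite /paley /= inE subrr eqxx. Qed.

Lemma unit_powersN1 (F : finFieldType) (k : nat) :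
  #|F| = 1 %[mod 2 * k] -> -1 \in unit_powers F k.
Proof.
move=> hq; rewrite inE oppr_eq0 oner_eq0 /=.
have F1 : (1 < #|F|)%N := finNzRing_gt1 F.
have /dvdnP[j hj] : (2 * k %| #|F| - 1)%N.
  by rewrite -eqn_mod_dvd ?(ltnW F1) // hq.
have {}hj : #|F|.-1 = ((j * k) * 2)%N by rewrite -subn1 hj mulnCA mulnC.
have N0 : (0 < j * k)%N.
  by rewrite lt0n; apply: contraTneq F1 => N0; move: hj; rewrite N0; case: #|F| => [|[]].
have [x x0 xN] : exists2 x : F, x != 0 & x ^+ (j * k) != 1.
  apply/exists_inP; apply: contraT => /exists_inPn H.
  have /(max_unity_roots N0) : all (j * k).-unity_root (enum [pred x : F | x != 0]).
    apply/allP => x; rewrite mem_enum => /H; rewrite negbK => /eqP xN.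
    by apply/unity_rootP.
  rewrite enum_uniq -cardE => /(_ isT).
  have := cardC1 (0 : F); rewrite hj => E; rewrite (eq_card (B := predC1 0)) // E.
  by rewrite muln2 -addnn -[leqRHS]addn0 leq_add2l leqNgt N0.
apply/existsP; exists (x ^+ j); rewrite expf_neq0 //= -exprM.
have : x ^+ (j * k) ^+ 2 == 1.
  rewrite -exprM -hj; apply/eqP/(mulfI x0).
  by rewrite -exprS prednK ?(ltnW F1) // expf_card mulr1.
by rewrite sqrf_eq1 (negbTE xN) /= eq_sym.
Qed.

Lemma paley_sym (F : finFieldType) (k : nat) :
  #|F| = 1 %[mod 2 * k] -> symmetric (@paley F k).
Proof.
move=> hq.
have opp_in (a : F) : a \in unit_powers F k -> - a \in unit_powers F k.
  have := unit_powersN1 hq; rewrite !inE !oppr_eq0.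
  move=> /andP[_ /existsP[c /andP[c0 /eqP hc]]].
  move=> /andP[-> /existsP[b /andP[b0 /eqP ->]]] /=.
  apply/existsP; exists (c * b).
  by rewrite mulf_neq0 //= exprMn -hc mulN1r.
by move=> x y; apply/idP/idP => /opp_in; rewrite opprB.
Qed.

(* Main.v *)
Require Import Defs.
From mathcomp Require Import all_boot all_algebra all_field.
From mathcomp Require Import zify.

(** The vertices connected to 0 are the sums of nonzero k-th powers, so they
    form a subfield K of F.  If K were proper, then |K|^2 <= q; on the other hand
    K contains all k-th powers, and x |-> x^k has fibres of size at most k, so
    q - 1 <= k (|K| - 1).  Together these give |K| + 1 <= k, whence
    q <= (k - 1)^2, which contradicts q >= 2^k. *)

Set Implicit Arguments.
Unset Strict Implicit.
Unset Printing Implicit Defensive.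

Import GRing.Theory.
Local Open Scope ring_scope.

(** An edge need only be sent to a path, not to an edge; [paley_component0M] relies on this. *)
Lemma homo_connect (T : finType) (e : rel T) (f : T -> T) :
  {homo f : x y / e x y >-> connect e x y} -> {homo f : x y / connect e x y}.
Proof.
move=> ef x y /connectP[s es ->] {y}.
elim: s x es => [|z s IHs] x //= /andP[exz /IHs]; exact/connect_trans/ef.
Qed.

(** For [x] outside [K], the elements 1 and [x] are linearly independent over [K], so
    [(a, b) |-> a + b * x] embeds [K * K] into [F]. *)
Lemma card_proper_subfield (F : finFieldType) (K : {set F}) :
  divring_closed K -> K != setT -> (#|K| ^ 2 <= #|F|)%N.
Proof.
move=> [_ KB Kdiv]; rewrite -subTset => /subsetPn[x _ Kx].
rewrite -mulnn -cardsX -cardsT.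
have finj : {in setX K K &, injective (fun u : F * F => u.1 + u.2 * x)}.
  move=> [a b] [c d]; rewrite !in_setX /= => /andP[Ka Kb] /andP[Kc Kd] eq_abcd.
  have {eq_abcd} eq_x : (b - d) * x = c - a.
    by rewrite mulrBl; apply/eqP; rewrite subr_eq addrAC -eq_abcd addrAC subrr add0r.
  have [eq_bd | neq_bd] := eqVneq b d.
    by move/esym/eqP: eq_x; rewrite eq_bd subrr mul0r subr_eq0 => /eqP->.
  case/negP: Kx; suff -> : x = (c - a) / (b - d) by apply: Kdiv; apply: KB.
  by rewrite -eq_x mulrAC mulfV ?mul1r // subr_eq0.
by rewrite -(card_in_imset finj) subset_leq_card ?subsetT.
Qed.

Lemma card_exp_fibre (F : finFieldType) (k : nat) (c : F) :
  (0 < k)%N -> (#|[set x : F | x ^+ k == c]| <= k)%N.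
Proof.
move=> k_gt0; rewrite cardE -ltnS -(size_XnsubC c k_gt0).
apply: max_poly_roots; rewrite ?enum_uniq //.
  by rewrite -size_poly_eq0 size_XnsubC.
by apply/allP=> x; rewrite mem_enum inE rootE !hornerE subr_eq0.
Qed.

Lemma card_unit_powers (F : finFieldType) (k : nat) :
  (0 < k)%N -> (#|F|.-1 <= k * #|unit_powers F k|)%N.
Proof.
move=> k_gt0; rewrite -(cardC1 (0 : F)) mulnC -sum_nat_const -sum1_card.
rewrite (partition_big (fun x : F => x ^+ k) (mem (unit_powers F k))) /=.
  apply: leq_sum => c _; apply: leq_trans _ (card_exp_fibre c k_gt0).
  rewrite sum1_card; apply/subset_leq_card/subsetP=> x.
  by rewrite !inE => /andP[].
move=> x x_neq0; rewrite !inE in x_neq0 *; rewrite expf_neq0 //=.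
by apply/existsP; exists x; rewrite x_neq0 /=.
Qed.

Section Component.

Variables (F : finFieldType) (k : nat).

Let component0 : {set F} := [set x | connect (@paley F k) x 0].

Lemma connect_paleyD (z : F) :
  {homo +%R^~ z : x y / connect (@paley F k) x y}.
Proof.
apply: homo_connect => x y exy; apply: connect1.
by rewrite /paley /= opprD addrACA subrr addr0.
Qed.

Lemma paley_component0D (x y : F) :
  x \in component0 -> y \in component0 -> x + y \in component0.
Proof.
rewrite !inE => /(connect_paleyD y); rewrite add0r; exact: connect_trans.
Qed.

Lemma unit_powers_sub_component0 : unit_powers F k \subset component0.
Proof. by apply/subsetP=> a Pa; rewrite inE connect1 // /paley /= subr0. Qed.

(** Scaling by a nonzero k-th power preserves edges and fixes 0, so it carries a path to 0 to
    another such path. *)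
Lemma paley_component0Ml (a x : F) :
  a \in unit_powers F k -> x \in component0 -> a * x \in component0.
Proof.
rewrite !inE => /andP[a_neq0 /existsP[b /andP[b_neq0 /eqP eq_a]]].
rewrite -[X in _ -> connect _ _ X](mulr0 a).
apply: (homo_connect (f := *%R a)) => y z.
rewrite /paley /= => eyz; apply: connect1; move: eyz; rewrite /= -mulrBr !inE.
case/andP=> yz_neq0 /existsP[c /andP[c_neq0 /eqP ->]].
rewrite eq_a -exprMn expf_neq0 ?mulf_neq0 //=.
by apply/existsP; exists (b * c); rewrite mulf_neq0 /=.
Qed.

Lemma paley_component0M (x y : F) :
  x \in component0 -> y \in component0 -> x * y \in component0.
Proof.
move=> + Ky; rewrite !inE -[X in _ -> connect _ _ X](mul0r y).
(* For an edge [u], [v] the difference [u - v] is a k-th power, so [(u - v) * y] is connected to 0;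
   translating by [v * y] connects [u * y] to [v * y]. *)
apply: (homo_connect (f := *%R^~ y)) => u v /paley_component0Ml/(_ Ky).
by rewrite inE mulrBl => /(connect_paleyD (v * y)); rewrite subrK add0r.
Qed.

Lemma paley_component0_divring :
  (#|F| = 1 %[mod 2 * k])%N -> divring_closed component0.
Proof.
move=> hmod.
have K1 : 1 \in component0.
  apply: (subsetP unit_powers_sub_component0); rewrite inE oner_eq0.
  by apply/existsP; exists 1; rewrite oner_eq0 expr1n /=.
have KN1 := subsetP unit_powers_sub_component0 _ (unit_powersN1 hmod).
split=> // x y Kx Ky.
  by rewrite -mulN1r; apply: paley_component0D => //; apply: paley_component0M.
apply: paley_component0M => //; have [->|y_neq0] := eqVneq y 0.
  by rewrite invr0 inE.
(* Closure under inverses reduces to closure under products. Cancelling [y] twice turns the claim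
   into [y ^+ #|F| = y]. *)
have -> : y^-1 = y ^+ (#|F| - 2).
  apply: (mulfI y_neq0); rewrite mulfV // -exprS; apply: (mulfI y_neq0).
  have F_gt1 := finNzRing_gt1 F.
  by rewrite -exprS (_ : (_ - 2).+2 = #|F|) ?expf_card ?mulr1 // -addn2 subnK.
elim: (#|F| - 2)%N => [|n IHn]; first by rewrite expr0.
by rewrite exprS; apply: paley_component0M.
Qed.

Lemma paley_component0T :
  (0 < k)%N -> (#|F| = 1 %[mod 2 * k])%N -> (k.-1 ^ 2 < #|F|)%N ->
  component0 = setT.
Proof.
move=> k_gt0 hmod k_small; apply/eqP/contraT=> K_proper.
have := card_proper_subfield (paley_component0_divring hmod) K_proper.
have := card_unit_powers F k_gt0.
(* The inclusion is strict because 0 lies in the component but is not a nonzero power. *)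
have : (#|unit_powers F k| < #|component0|)%N.
  apply/proper_card/properP; split; first exact: unit_powers_sub_component0.
  by exists 0; rewrite !inE ?eqxx.
have := finNzRing_gt1 F; move: k_small k_gt0.
move: #|F| #|unit_powers F k| #|component0| => q P K *.
have K_gt1 : (1 < K)%N by nia.
(* Cancel [K - 1 > 0] in [K ^ 2 - 1 <= q - 1 <= k * (K - 1)]. *)
have K_lt_k : (K < k)%N by nia.
nia.
Qed.

End Component.

Local Close Scope ring_scope.

Lemma sqr_predn_lt_exp2 (k : nat) : k.-1 ^ 2 < 2 ^ k.
Proof.
(* Induction starts at 4, since the step needs [k ^ 2 <= 2 * (k - 1) ^ 2], which fails at 3. *)
case: k => [|[|[|[|]]]] // n /=.
elim: n => // n IHn; rewrite [X in (_ < X)]expnS; nia.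
Qed.

Theorem theorem1p4 (m k p q : nat) (F : finFieldType)
  (hm : 1 <= m) (hk : 2 <= k) (hp : prime p) (hq : q = p ^ (k * m))
  (hmod : q = 1 %[mod 2 * k]) (hF : #|F| = q) :
  connected_graph (@paley F k).
Proof.
have k_small : k.-1 ^ 2 < #|F|.
  rewrite hF hq; apply: leq_trans (sqr_predn_lt_exp2 k) _.
  apply: (@leq_trans (p ^ k)); first by rewrite leq_exp2r ?prime_gt1 // ltnW.
  by rewrite leq_pexp2l ?prime_gt0 // leq_pmulr.
rewrite -hF in hmod; move=> x y.
(* Translating a path from [x - y] to 0 by [y] gives one from [x] to [y]. *)
have := in_setT (x - y)%R; rewrite -(paley_component0T _ hmod) // ?(ltnW hk) //.
by rewrite inE => /(connect_paleyD y); rewrite subrK add0r.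
Qed.
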